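(* Let $V\in C^2(\mathbb{R}^m)$ be such that $\mu(\mathrm{d}x)=e^{-V(x)}\mathrm{d}x$ is a probability measure on $\mathbb{R}^m$. Suppose that $$\liminf_{|x|\to\infty}\ \sum_{i=1}^m\left[\frac{23}{27}\left(\frac{\partial V}{\partial x_i}\right)^2(x)-\frac{\partial^2V}{\partial x_i^2}(x)\right]\frac{1}{1+x_i^2}\geqslant m .$$ Then $\int e^{\delta|x|^2}\,\mathrm{d}\mu(x)<\infty$ for any $\delta<\dfrac{2(\sqrt{m}-\sqrt{m-1})}{3\sqrt{3m}}$.
   Context: $|x|$ denotes the Euclidean norm on $\mathbb{R}^m$, $m\geqslant 1$, and $x=(x_1,\dots,x_m)$. *)

(* Defs.v *)
From HB Require Import structures.
From mathcomp Require Import all_boot all_order all_algebra.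
From mathcomp Require Import all_classical all_reals all_analysis.

Set Implicit Arguments.
Unset Strict Implicit.
Unset Printing Implicit Defensive.

Import Order.TTheory GRing.Theory Num.Theory.
Import numFieldNormedType.Exports.

Local Open Scope classical_set_scope.
Local Open Scope ring_scope.

(* Row vectors carry the product sigma-algebra, as tuples do in the library;
   over the reals this is the Borel sigma-algebra. *)
Section measurable_rV.
Context {d} {T : measurableType d}.
Variable n : nat.

Let coors : 'I_n -> 'rV[T]_n -> T := fun i x => x ord0 i.

Let rV_set0 : g_sigma_preimage coors set0.
Proof. exact: sigma_algebra0. Qed.

Let rV_setC A : g_sigma_preimage coors A -> g_sigma_preimage coors (~` A).
Proof. exact: sigma_algebraC. Qed.

Let rV_bigcup (F : _^nat) : (forall i, g_sigma_preimage coors (F i)) ->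
  g_sigma_preimage coors (\bigcup_i (F i)).
Proof. exact: sigma_algebra_bigcup. Qed.

HB.instance Definition _ := @isMeasurable.Build (measure_tuple_display d)
  'rV[T]_n (g_sigma_preimage coors) rV_set0 rV_setC rV_bigcup.

End measurable_rV.

Lemma measurable_coord d (T : measurableType d) n (i : 'I_n) :
  measurable_fun [set: 'rV[T]_n] (fun x => x ord0 i).
Proof.
move=> _ Y mY; rewrite setTI; apply: sub_sigma_algebra => /=.
rewrite -bigcup_seq/=; exists i => /=; first by rewrite mem_index_enum.
by exists Y => //; rewrite setTI.
Qed.

Lemma measurable_fun_rVP d1 d2 (T1 : measurableType d1)
    (T2 : measurableType d2) n (f : T1 -> 'rV[T2]_n) :
  measurable_fun [set: T1] f <->
  forall i, measurable_fun [set: T1] (fun x => f x ord0 i).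
Proof.
split=> [mf i|mf].
  exact: (measurableT_comp (@measurable_coord _ T2 n i) mf).
have := @g_sigma_preimage_comp _ T2 n 'rV[T2]_n (fun i x => x ord0 i) T1 f.
move=> E.
have sub : g_sigma_preimage (fun i : 'I_n => (fun x : 'rV[T2]_n => x ord0 i) \o f)
    `<=` measurable.
  apply: smallest_sub; first exact: sigma_algebra_measurable.
  rewrite -bigcup_seq/=; apply: bigcup_sub => i _ A [B mB <-]; exact: mf.
by move=> _ A mA; apply: sub; rewrite E; exists A.
Qed.

Section lebesgue_rV.
Context {R : realType}.

Definition cons_rV n (p : measurableTypeR R * 'rV[R]_n) : 'rV[R]_n.+1 :=
  row_mx (p.1)%:M p.2 : 'rV[R]_(1 + n).

Fixpoint lebesgue_rV n : set 'rV[R]_n -> \bar R :=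
  if n is n'.+1 then
    pushforward (lebesgue_measure \x @lebesgue_rV n')%E (@cons_rV n')
  else \d_ (0 : 'rV[R]_0).

Definition uncons_rV n (v : 'rV[R]_n.+1) : measurableTypeR R * 'rV[R]_n :=
  (v ord0 ord0, \row_j v ord0 (lift ord0 j)).

Lemma cons_rV0 n (p : measurableTypeR R * 'rV[R]_n) : cons_rV p ord0 ord0 = p.1.
Proof.
have e : (ord0 : 'I_(1 + n)) = lshift n (ord0 : 'I_1) by exact/val_inj.
apply: (etrans (congr1 (cons_rV p ord0) e)).
apply: (etrans (row_mxEl (p.1)%:M p.2 ord0 ord0)).
by rewrite mxE eqxx mulr1n.
Qed.

Lemma cons_rVS n (p : measurableTypeR R * 'rV[R]_n) j :
  cons_rV p ord0 (lift ord0 j) = p.2 ord0 j.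
Proof.
have e : (lift ord0 j : 'I_(1 + n)) = rshift 1 j by exact/val_inj.
apply: (etrans (congr1 (cons_rV p ord0) e)).
exact: (row_mxEr (p.1)%:M p.2 ord0 j).
Qed.

Lemma cons_rVK n : cancel (@cons_rV n) (@uncons_rV n).
Proof.
move=> [a v]; rewrite /uncons_rV cons_rV0; congr pair.
by apply/rowP => j; rewrite mxE cons_rVS.
Qed.

Lemma measurable_cons_rV n : measurable_fun [set: measurableTypeR R * 'rV[R]_n] (@cons_rV n).
Proof.
apply/measurable_fun_rVP => i; case: (unliftP ord0 i) => [j|] ->.
  under eq_fun do rewrite cons_rVS.
  exact: (measurableT_comp (@measurable_coord _ R n j) measurable_snd).
under eq_fun do rewrite cons_rV0.
exact: measurable_fst.
Qed.

Lemma measurable_uncons_rV n :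
  measurable_fun [set: 'rV[R]_n.+1] (@uncons_rV n).
Proof.
apply: measurable_fun_pair; first exact: measurable_coord.
apply/measurable_fun_rVP => i.
under eq_fun do rewrite mxE.
exact: measurable_coord.
Qed.

Let lebesgue_rV_ex n :
  exists mu : {sigma_finite_measure set 'rV[R]_n -> \bar R},
    @lebesgue_rV n = mu.
Proof.
elim: n => [|n [mu IH]]; first by exists (\d_ (0 : 'rV[R]_0)).
pose lm : {sigma_finite_measure set (measurableTypeR R) -> \bar R} := lebesgue_measure.
pose nu : {measure set 'rV[R]_n.+1 -> \bar R} :=
  measure_function_pushforward__canonical__measure_function_Measure
    (lm \x mu)%E (@measurable_cons_rV n).
have sf : sigma_finite [set: 'rV[R]_n.+1] nu.
  have /sigma_finiteP[F [TF ndF Foo]] := sigma_finiteT lm.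
  have /sigma_finiteP[G [TG ndG Goo]] := sigma_finiteT mu.
  exists (fun k => @uncons_rV n @^-1` (F k `*` G k)).
    rewrite -preimage_bigcup (_ : \bigcup_k _ = setT) ?preimage_setT//.
    rewrite -subTset -setXTT TF TG => -[x y] [/= [i _ Fix] [j _ Gjy]].
    exists (maxn i j) => //; split.
    - by move: x Fix; exact/subsetPset/ndF/leq_maxl.
    - by move: y Gjy; exact/subsetPset/ndG/leq_maxr.
  move=> k; have [mF Fk] := Foo k; have [mG Gk] := Goo k; split.
    rewrite -[X in measurable X]setTI.
    by apply: measurable_uncons_rV => //; exact: measurableX.
  rewrite /= /pushforward -comp_preimage (_ : _ \o _ = id); last first.
    by apply/funext => p /=; rewrite cons_rVK.
  rewrite preimage_id product_measure1E//.
  by rewrite lte_mul_pinfty// ge0_fin_numE.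
pose S := Measure_isSigmaFinite.Build _ _ _ nu sf.
pose nu' : {sigma_finite_measure set 'rV[R]_n.+1 -> \bar R} :=
  HB.pack (Measure.sort nu) S.
by exists nu'; rewrite /= IH.
Qed.

Let lebesgue_rV_measure0 n : @lebesgue_rV n set0 = 0%E.
Proof. by have [mu ->] := lebesgue_rV_ex n; exact: measure0. Qed.

Let lebesgue_rV_ge0 n A : (0 <= @lebesgue_rV n A)%E.
Proof. by have [mu ->] := lebesgue_rV_ex n; exact: measure_ge0. Qed.

Let lebesgue_rV_sigma_additive n : semi_sigma_additive (@lebesgue_rV n).
Proof.
by have [mu ->] := lebesgue_rV_ex n; exact: measure_semi_sigma_additive.
Qed.

HB.instance Definition _ n := isMeasure.Build _ _ _ (@lebesgue_rV n)
  (@lebesgue_rV_measure0 n) (@lebesgue_rV_ge0 n)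
  (@lebesgue_rV_sigma_additive n).

Let lebesgue_rV_sigma_finite n : sigma_finite setT (@lebesgue_rV n).
Proof. by have [mu ->] := lebesgue_rV_ex n; exact: sigma_finiteT. Qed.

HB.instance Definition _ n := Measure_isSigmaFinite.Build _ _ _
  (@lebesgue_rV n) (@lebesgue_rV_sigma_finite n).

End lebesgue_rV.
Arguments lebesgue_rV {R} n.

Section euclidean.
Context {R : realType} {m : nat}.
Implicit Types (x : 'rV[R]_m) (f : 'rV[R]_m -> R).

(* The library's norm on row vectors is the sup norm. *)
Definition enorm x : R := Num.sqrt (\sum_i x ord0 i ^+ 2).

(* The filter of neighbourhoods of infinity: |x| -> +oo. *)
Definition enorm_pinfty : set_system 'rV[R]_m :=
  filter_from [set: R] (fun r => [set x | r < enorm x]).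

Definition partial (i : 'I_m) f : 'rV[R]_m -> R :=
  fun x => 'D_(delta_mx ord0 i) f x.

Fixpoint Ck k f : Prop :=
  continuous f /\
  if k is k'.+1 then
    forall i, (forall x, derivable f x (delta_mx ord0 i)) /\ Ck k' (partial i f)
  else True.

End euclidean.

(* Main.v *)
Require Import Defs.
From HB Require Import structures.
From mathcomp Require Import all_boot all_order all_algebra.
From mathcomp Require Import all_classical all_reals all_analysis.
From mathcomp Require Import measurable_realfun ring lra.

Set Implicit Arguments.
Unset Strict Implicit.
Unset Printing Implicit Defensive.

Import Order.TTheory GRing.Theory Num.Theory.
Import numFieldNormedType.Exports.

Local Open Scope classical_set_scope.
Local Open Scope ring_scope.

(** The weighted Dirichlet form [sum_i w_i (d_i f)^2], with
[w_i = 1 / (1 + x_i^2)], is the right one for this hypothesis, and the proof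
is an Agmon-type estimate for it: the hypothesis gives a spectral gap at
infinity, and [exp (2 g)] is integrable when the weighted squared gradient of
[g] stays below that gap.

Let [E] be a function of [r = |x|^2] with [E >= 1] and [E = 1] outside a
compact set.  The integral of the divergence of the compactly supported field
with components [(E - 1)^2 exp(-V) w_i d_i V] is zero
([integral_divergence]).  Expand the divergence and use Young's inequality
twice: once with a parameter [a] on the product of [d_i V] and [d_i E], once
with a parameter [s] on the product of [d_i V] and [d_i w_i].  Together they
cost [a + s] times [(d_i V)^2], and [a + s = 4/27 = 1 - 23/27] is exactly what
the hypothesis leaves ([divergence_le]).  What remains, besides the
sum [Q] of the hypothesis, is [sum_i x_i^2 w_i^3 / s] and the gradient term
of size [m delta^2 E^2 / a], when [E = exp h] with [|h'(r)| <= delta / 2].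

Each [x_i^2 w_i^3] is at most [4/27], whence the sharp constant; and far from
the origin one coordinate is large, so one of the [m] terms is negligible
([weight_sum_tail]).  So outside a ball the divergence is at most
[exp(-V) (- A (E - 1)^2 + B E^2)] with [A] close to [m - (m - 1) (4/27) / s] and
[B = m delta^2 / a].  Optimizing over [a + s = 4/27], the condition [B < A] can
be met exactly when [delta] is below the bound of the theorem
([gap_parameters]).

Consequently the divergence is at most [exp(-V) (K - c E^2)] with [c > 0] and
[K] independent of the truncation ([divergence_le_growth]), and integration
gives [c * int E^2 exp(-V) <= K].  Taking [h(r) = (delta / 2) r (1 - r/N)_+^2],
which increases to [delta r / 2] with [N], monotone convergence yields
the claim for [exp(delta |x|^2)] ([exponential_moment_lty]). *)

(** * Continuous functions of row vectors are measurable *)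

Lemma measurable_countable_fiber d1 d2 (X : measurableType d1)
    (Y : measurableType d2) (C : countType) (Z : X -> C) (g : C -> Y) :
  (forall c, measurable (Z @^-1` [set c])) -> measurable_fun setT (g \o Z).
Proof.
move=> mZ _ B mB; rewrite setTI.
rewrite (_ : _ @^-1` B = \bigcup_(c in [set: {c | `[< B (g c) >]}])
    Z @^-1` [set sval c]).
  apply: countable_bigcupT_measurable => [|c]; last exact: mZ.
  exact: countableP.
apply/seteqP; split=> [x /= Bx|x [[c /= /asboolP Bc] _ /= ->]//].
by exists (exist _ (Z x) (asboolT Bx)).
Qed.

Lemma cvg_rV (R : realType) n (T : Type) (F : set_system T) {FF : Filter F}
    (u : T -> 'rV[R]_n) (x : 'rV[R]_n) :
  (forall i, u k ord0 i @[k --> F] --> x ord0 i) -> u k @[k --> F] --> x.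
Proof.
move=> ux; apply/cvgrPdist_lt => e e0.
have : \forall k \near F, forall j : 'I_n, `|x ord0 j - u k ord0 j| < e.
  by apply: filter_forall => j; have /cvgrPdist_lt := ux j; exact.
apply: filterS => k xu.
rewrite [ltLHS]mx_normrE; apply: bigmax_lt => //= -[i j] _ /=.
by rewrite ord1 !mxE.
Qed.

Lemma cvg_floor_div (R : realType) (t : R) :
  (Num.floor (k.+1%:R * t))%:~R / k.+1%:R @[k --> \oo] --> t.
Proof.
apply: (@squeeze_cvgr _ _ _ _ (fun k : nat => t - k.+1%:R^-1) (cst t)).
- near=> k; have k0 : (0 : R) < k.+1%:R by rewrite ltr0n.
  have /andP[fl fu] := floor_itv (k.+1%:R * t).
  rewrite /= ler_pdivlMr// ler_pdivrMr// mulrBl mulVf ?gt_eqF// lerBlDr.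
  by rewrite (mulrC t) fl andbT ltW// -[1]/(1%:~R) -intrD.
- rewrite -[X in _ --> X]subr0; apply: cvgB; first exact: cvg_cst.
  exact: cvg_harmonic.
- exact: cvg_cst.
Unshelve. all: by end_near. Qed.

(** The sigma-algebra is generated by the coordinates, so open sets are not
measurable by definition.  But [f] is the pointwise limit of its values at the
grid points [floor (k x) / k], and these range over a countable set on whose
fibers, which are boxes, the approximants are constant. *)
Lemma continuous_measurable_rV (R : realType) n (f : 'rV[R]_n -> R) :
  continuous f -> measurable_fun setT f.
Proof.
move=> cf.
pose Z k (x : 'rV[R]_n) : 'rV[int]_n := \row_i Num.floor (k.+1%:R * x ord0 i).
pose g k (z : 'rV[int]_n) : R := f (\row_i ((z ord0 i)%:~R / k.+1%:R)).
apply: (@measurable_fun_cvg _ _ _ _ (fun k => g k \o Z k)).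
  move=> k; apply: measurable_countable_fiber => z.
  rewrite (_ : _ @^-1` _ = \bigcap_(i in [set: 'I_n])
      ((fun x : 'rV[R]_n => k.+1%:R * x ord0 i) @^-1`
        `[(z ord0 i)%:~R, (z ord0 i + 1)%:~R[)).
    apply: fin_bigcap_measurable => [|i _]; first exact: finite_finset.
    rewrite -[X in measurable X]setTI.
    have : measurable_fun setT (fun x : 'rV[R]_n => k.+1%:R * x ord0 i).
      by apply: measurable_funM => //; exact: measurable_coord.
    by apply => //; exact: measurable_itv.
  apply/seteqP; split=> [x /= xz i _ /=|x xz /=].
    by rewrite -xz mxE in_itv/= floor_itv.
  apply/rowP => i; rewrite mxE; apply/eqP; rewrite floor_eq.
  by have := xz i I; rewrite /= in_itv.
move=> x _; apply: continuous_cvg; first exact: cf.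
apply: cvg_rV => i; rewrite /Z /=.
under eq_fun do rewrite !mxE.
exact: cvg_floor_div.
Qed.

(** * Directional derivatives and compactly supported functions *)

(** A directional derivative only sees the restriction to a line, so it can be
computed after an affine reparametrization; this is how derivatives pass between
row vectors, their slices and real functions. *)
Lemma is_derive_affine (R : numFieldType) (U V W : normedModType R)
    (f : V -> W) (j : U -> V) (x u : U) (v : V) (df : W) :
  (forall h : R, j (h *: u + x) = h *: v + j x) ->
  is_derive (j x) v f df <-> is_derive x u (f \o j) df.
Proof.
move=> jE.
have E : (fun h : R => h^-1 *: ((f \o j \o shift x) (h *: u) - (f \o j) x)) =
         (fun h : R => h^-1 *: ((f \o shift (j x)) (h *: v) - f (j x))).
  by apply/funext => h /=; rewrite jE.
by split=> -[fx <-]; split;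
  [rewrite /derivable E|rewrite /derive E
  |rewrite /derivable -E|rewrite /derive -E].
Qed.

Lemma is_derive_comp1 (R : realType) (V : normedModType R) (f : V -> R)
    (g : R -> R) (x v : V) (df dg : R) :
  is_derive x v f df -> is_derive (f x) 1 g dg ->
  is_derive x v (g \o f) (dg * df).
Proof.
move=> fx gx; pose j (h : R) : V := h *: v + x.
have jE (h : R) : j (h *: (1 : R) + 0) = h *: v + j 0.
  by rewrite /j addr0 scale0r add0r [h *: 1]mulr1.
have j0 : j 0 = x by rewrite /j scale0r add0r.
rewrite -[x]j0; apply/(is_derive_affine _ _ jE).
apply: (@is_derive1_comp _ g (f \o j)); first by rewrite /= j0.
by apply/(is_derive_affine _ _ jE); rewrite j0.
Qed.

(** As the error bound is required for every increment, a piecewise polynomial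
needs no separate limits at its break points. *)
Lemma is_derive_quadratic (R : realType) (f : R -> R) (x d C : R) :
  (forall h, `|f (h + x) - f x - d * h| <= C * h ^+ 2) -> is_derive x 1 f d.
Proof.
move=> fC.
have df : (fun h => h^-1 *: ((f \o shift x) (h *: (1 : R)) - f x)) @ 0^' --> d.
  apply/cvgrPdist_le => e e0; near=> h.
  have h0 : h != 0 by near: h; exact: nbhs_dnbhs_neq.
  have he : `|h| <= e / (`|C| + 1).
    near: h; apply: dnbhs0_le; rewrite divr_gt0// ltr_wpDl//.
  rewrite /= -[_ *: _]/(h^-1 * _) [h *: 1]mulr1.
  rewrite -(mulKf h0 d) -mulrBr normrM normfV ler_pdivrMl ?normr_gt0//.
  rewrite distrC (mulrC h d) (le_trans (fC h))//.
  have -> : C * h ^+ 2 = `|h| * (C * `|h|).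
    by rewrite -[h ^+ 2]real_normK ?num_real//; ring.
  rewrite ler_wpM2l// (le_trans (ler_wpM2r _ (ler_norm C)))// mulrC.
  rewrite (le_trans (ler_wpM2r _ he))// -mulrA ler_piMr ?(ltW e0)//.
  by rewrite mulrC ler_pdivrMr ?ltr_wpDl// mul1r lerDl.
split; first exact: cvgP df.
exact: cvg_lim df.
Unshelve. all: by end_near. Qed.

Definition cube (R : realType) n (M : R) : set 'rV[R]_n :=
  [set x | forall i, `|x ord0 i| <= M].
Arguments cube {R} n M.

Lemma measurable_cube (R : realType) n (M : R) : measurable (cube n M).
Proof.
rewrite (_ : cube n M = \bigcap_(i in [set: 'I_n])
    ((fun x : 'rV[R]_n => x ord0 i) @^-1` `[- M, M])).
  apply: fin_bigcap_measurable => [|i _]; first exact: finite_finset.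
  rewrite -[X in measurable X]setTI.
  have mi := @measurable_coord _ (measurableTypeR R) n i.
  by apply: mi => //; exact: measurable_itv.
by apply/seteqP; split=> x /= xM i => [_|]; have := xM i;
  rewrite /= in_itv/= -ler_norml//; exact.
Qed.

Lemma lebesgue_cube_lty (R : realType) n (M : R) :
  (lebesgue_rV n (cube n M) < +oo)%E.
Proof.
elim: n => [|n IHn]; first by rewrite /= diracE ltry.
rewrite /= /pushforward (_ : _ @^-1` _ = `[- M, M] `*` cube n M).
  rewrite product_measure1E//; last exact: measurable_cube.
  apply: lte_mul_pinfty => //.
  rewrite ge0_fin_numE// [ltLHS]lebesgue_measure_itv/=.
  by case: ifP; rewrite ltry.
apply/seteqP; split=> [[t v] /= tvM|[t v] [/= tM vM] i].
  rewrite in_itv/= -ler_norml; split=> [|i].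
    by have := tvM ord0; rewrite cons_rV0.
  by have := tvM (lift ord0 i); rewrite cons_rVS.
case: (unliftP ord0 i) => [j|] ->; first by rewrite cons_rVS; exact: vM.
by rewrite cons_rV0 ler_norml; move: tM; rewrite in_itv.
Qed.

Lemma compact_cube (R : realType) n (M : R) : compact (cube n M).
Proof.
rewrite (_ : cube n M = [set x | forall i, `[- M, M]%classic (x ord0 i)]).
  by apply: (@rV_compact _ _ (fun=> `[- M, M]%classic)) => _;
    exact: segment_compact.
by apply/seteqP; split=> x /= xM i; have := xM i; rewrite in_itv/= ler_norml.
Qed.

Lemma continuous_cube_bounded (R : realType) n (f : 'rV[R]_n -> R) (M : R) :
  continuous f -> exists K, forall x, cube n M x -> f x <= K.
Proof.
move=> cf; have [cube0|/set0P cube0] := eqVneq (cube n M) set0.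
  by exists 0 => x; rewrite cube0.
have [c _ fc] := EVT_max_rV cube0 (@compact_cube _ _ M)
  (continuous_subspaceT cf).
by exists (f c) => x xM; apply: fc; rewrite inE.
Qed.

Lemma integrable_continuous_cube (R : realType) n (f : 'rV[R]_n -> R) (M : R) :
  continuous f -> (forall x, ~ cube n M x -> f x = 0) ->
  (lebesgue_rV n).-integrable setT (EFin \o f).
Proof.
move=> cf f0.
have -> : EFin \o f = (EFin \o f) \_ (cube n M).
  apply/funext => x; rewrite patchE; case: ifPn => // /negP xM /=.
  by rewrite f0// => /mem_set.
apply/(integrable_mkcond _ (@measurable_cube R n M)).
apply: measurable_bounded_integrable.
- exact: measurable_cube.
- exact: lebesgue_cube_lty.
- exact: measurable_funTS (continuous_measurable_rV cf).
- have [K fK] := continuous_cube_bounded M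
    (fun x => cvg_norm (cf x) : {for x, continuous (fun x => `|f x|)}).
  exists K; split; first exact: num_real.
  by move=> K' KK' x xM; exact: le_trans (fK x xM) (ltW KK').
Qed.

Lemma integral_derive_eq0 (R : realType) (f g : R -> R) (M : R) :
  (forall x : R, is_derive x 1 f (g x)) -> continuous g ->
  (forall x, M < `|x| -> f x = 0 /\ g x = 0) ->
  (\int[lebesgue_measure]_x (g x)%:E = 0)%E.
Proof.
move=> df cg f0; pose a : R := `|M| + 1.
have Ma : M < a by rewrite (le_lt_trans (ler_norm M))// ltrDl.
have a0 : 0 < a by rewrite ltr_wpDl.
have cf : continuous f.
  move=> x; apply/differentiable_continuous/derivable1_diffP.
  by have [] := df x.
transitivity (\int[lebesgue_measure]_(x in `[(- a)%R, a]) (g x)%:E)%E.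
  rewrite [RHS]integral_mkcond; apply: eq_integral => x _.
  rewrite patchE; case: ifPn => // /negP xa.
  rewrite (f0 _ _).2// ltNge; apply/negP => xM; apply: xa.
  by rewrite inE/= in_itv/= -ler_norml (le_trans xM)// ltW.
rewrite (@continuous_FTC2 _ g f).
- by rewrite (f0 a _).1 ?(f0 (- a) _).1 ?normrN ?gtr0_norm// sube0.
- by rewrite gt0_cp.
- exact: continuous_subspaceT.
- split.
  + by move=> x _; have [] := df x.
  + exact/cvg_at_right_filter/cf.
  + exact/cvg_at_left_filter/cf.
- by move=> x _; rewrite derive1E; have [_ ->] := df x.
Qed.

(** * Integrals of partial derivatives *)

Lemma cons_rV_continuous1 (R : realType) n (v : 'rV[R]_n) :
  continuous (fun t : R => cons_rV (t, v)).
Proof.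
move=> t; apply: cvg_rV => i; case: (unliftP ord0 i) => [j|] ->.
  by under eq_fun do rewrite cons_rVS; rewrite cons_rVS; exact: cvg_cst.
by under eq_fun do rewrite cons_rV0; rewrite cons_rV0; exact: cvg_id.
Qed.

Lemma cons_rV_continuous2 (R : realType) n (t : R) :
  continuous (fun v : 'rV[R]_n => cons_rV (t, v)).
Proof.
move=> v; apply: (@cvg_rV _ _ _ _ (nbhs_filter v)) => i.
case: (unliftP ord0 i) => [j|] ->.
  under eq_fun do rewrite cons_rVS.
  by rewrite cons_rVS; exact: coord_continuous.
by under eq_fun do rewrite cons_rV0; rewrite cons_rV0; exact: cvg_cst.
Qed.

Lemma cons_rV_affine1 (R : realType) n (v : 'rV[R]_n) (t h : R) :
  cons_rV (h *: 1 + t, v) = h *: delta_mx ord0 ord0 + cons_rV (t, v).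
Proof.
apply/rowP => i; rewrite [RHS]mxE [X in _ = X + _]mxE [X in _ * X]mxE.
case: (unliftP ord0 i) => [j|] ->; first by rewrite !cons_rVS mulr0 add0r.
by rewrite !cons_rV0.
Qed.

Lemma cons_rV_affine2 (R : realType) n (t : R) (v : 'rV[R]_n) j (h : R) :
  cons_rV (t, h *: delta_mx ord0 j + v) =
  h *: delta_mx ord0 (lift ord0 j) + cons_rV (t, v).
Proof.
apply/rowP => i; rewrite [RHS]mxE [X in _ = X + _]mxE [X in _ * X]mxE.
case: (unliftP ord0 i) => [k|] ->.
  by rewrite !cons_rVS !mxE (inj_eq lift_inj).
by rewrite !cons_rV0 (_ : ord0 == lift ord0 j = false)// ?andbF ?mulr0 ?add0r.
Qed.

(** Integrate first in the direction of differentiation.  For the first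
coordinate the inner integral is that of the derivative of a compactly supported
function of one variable; the other coordinates are handled by induction on
the slices where the first one is fixed. *)
Lemma integral_partial_eq0 (R : realType) n (i : 'I_n) (F G : 'rV[R]_n -> R)
    (M : R) :
  (forall x, is_derive x (delta_mx ord0 i) F (G x)) -> continuous G ->
  (forall x, ~ cube n M x -> F x = 0 /\ G x = 0) ->
  (\int[lebesgue_rV n]_x (G x)%:E = 0)%E.
Proof.
elim: n => [|n IHn] in i F G *; first by case: i.
move=> dF cG F0.
have mG := continuous_measurable_rV cG.
have iG := integrable_continuous_cube cG (fun x xM => (F0 x xM).2).
have mcons := @measurable_cons_rV R n.
have ic : (lebesgue_measure \x lebesgue_rV n)%E.-integrable setT
    (fun p => (G (cons_rV p))%:E).
  apply/integrableP; split.
    by apply/measurable_EFinP; exact: measurableT_comp mG mcons.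
  have /integrableP[_] := iG; congr (_ < +oo)%E.
  have mE : measurable_fun setT (fun x => `|(G x)%:E|%E).
    by apply/measurableT_comp => //; exact/measurable_EFinP.
  have := ge0_integral_pushforward mcons
    (lebesgue_measure \x lebesgue_rV n)%E measurableT mE
    (fun x _ => abse_ge0 _).
  by rewrite preimage_setT.
transitivity (\int[lebesgue_measure \x lebesgue_rV n]_p (G (cons_rV p))%:E)%E.
  have mE : measurable_fun setT (EFin \o G) by exact/measurable_EFinP.
  have := @integral_pushforward _ _ _ _ _ _ mcons
    (lebesgue_measure \x lebesgue_rV n)%E setT _ mE.
  by rewrite preimage_setT => /(_ ic measurableT).
case: (unliftP ord0 i) => [j|] ij; rewrite ij in dF.
  rewrite -integral12_prod_meas1//; apply: integral0_eq => t _.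
  apply: (IHn j (fun v => F (cons_rV (t, v))) (fun v => G (cons_rV (t, v)))).
  - move=> v; apply: (is_derive_affine _ _ _).1 (dF _) => h.
    exact: cons_rV_affine2.
  - by move=> v; apply: continuous_comp; [exact: cons_rV_continuous2|exact: cG].
  - move=> v vM; apply: F0 => tvM; apply: vM => k.
    by have := tvM (lift ord0 k); rewrite cons_rVS.
rewrite -integral21_prod_meas1//; apply: integral0_eq => v _.
apply: (@integral_derive_eq0 _ (fun t => F (cons_rV (t, v)))
  (fun t => G (cons_rV (t, v))) M).
- move=> t; apply: (is_derive_affine _ _ _).1 (dF _) => h.
  exact: cons_rV_affine1.
- by move=> t; apply: continuous_comp; [exact: cons_rV_continuous1|exact: cG].
- move=> t tM; apply: F0 => /(_ ord0); rewrite cons_rV0 /=.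
  by rewrite leNgt tM.
Qed.

(** * The truncated exponent *)

Lemma is_derive_max_sqr (R : realType) (t : R) :
  is_derive t 1 (fun t => Num.max 0 t ^+ 2) (2 * Num.max 0 t).
Proof.
apply: (@is_derive_quadratic _ _ _ _ 1) => h; rewrite mul1r ler_norml.
by case: (lerP 0 t) => t0; case: (lerP 0 (h + t)) => ht0;
  apply/andP; split; nra.
Qed.

Definition cutoff (R : realType) (N r : R) : R := Num.max 0 (1 - r / N).

(** The exponent [h] of the test function.  The square of the cutoff makes it
continuously differentiable, and the product [t (1 - t)^2] has slope between
[-1/3] and [1] on the unit interval, so that truncation does not increase the
slope. *)
Definition ramp (R : realType) (delta N r : R) : R :=
  delta / 2 * r * cutoff N r ^+ 2.

(** The derivative of [t (1 - t)^2] is [c (3 c - 2)] with [c = 1 - t]; in this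
form it is also correct beyond the cutoff, where [c = 0]. *)
Definition dramp (R : realType) (delta N r : R) : R :=
  delta / 2 * (cutoff N r * (3 * cutoff N r - 2)).

Lemma is_derive_ramp (R : realType) (delta N r : R) : 0 < N ->
  is_derive r 1 (ramp delta N) (dramp delta N r).
Proof.
move=> N0.
have dl : is_derive r 1 (fun r => 1 - r / N) (- N^-1).
  apply: (@is_derive_quadratic _ _ _ _ 0) => h; rewrite mul0r normr_le0.
  by apply/eqP; ring.
have dc := is_derive_comp1 dl (is_derive_max_sqr (1 - r / N)).
have dd : is_derive r 1 (fun r => delta / 2 * r) (delta / 2).
  apply: (@is_derive_quadratic _ _ _ _ 0) => h; rewrite mul0r normr_le0.
  by apply/eqP; ring.
apply: is_derive_eq (is_deriveM dd dc) _.
rewrite /dramp -[_ *: _]/(_ * _) -[X in _ + X]/(_ * _) /= -/(cutoff N r).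
have [r1|r1] := leP (1 - r / N) 0.
  by rewrite (_ : cutoff N r = 0) /cutoff ?max_l//; ring.
have rN : r = N * (1 - cutoff N r).
  by rewrite /cutoff max_r ?ltW//; field; rewrite gt_eqF.
by rewrite {1}rN; field; rewrite gt_eqF.
Qed.

Lemma cutoff_ge0 (R : realType) (N r : R) : 0 <= cutoff N r.
Proof. by rewrite /cutoff le_max lexx. Qed.

Lemma cutoff_le1 (R : realType) (N r : R) : 0 < N -> 0 <= r -> cutoff N r <= 1.
Proof.
by move=> N0 r0; rewrite /cutoff ge_max ler01 gerBl divr_ge0// ltW.
Qed.

Lemma norm_dramp_le (R : realType) (delta N r : R) :
  0 <= delta -> 0 < N -> 0 <= r -> `|dramp delta N r| <= delta / 2.
Proof.
move=> d0 N0 r0; rewrite /dramp normrM (ger0_norm (divr_ge0 _ _))//.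
have := cutoff_ge0 N r; have := cutoff_le1 N0 r0.
move: (cutoff N r) => c c1 c0.
rewrite ler_piMr ?divr_ge0// ler_norml; apply/andP; split; nra.
Qed.

Lemma ramp_le (R : realType) (delta N r : R) :
  0 <= delta -> 0 < N -> 0 <= r -> ramp delta N r <= delta / 2 * r.
Proof.
move=> d0 N0 r0; rewrite /ramp ler_piMr ?mulr_ge0 ?divr_ge0//.
by rewrite expr_le1// ?cutoff_ge0 ?cutoff_le1.
Qed.

Lemma ramp_ge0 (R : realType) (delta N r : R) :
  0 <= delta -> 0 <= r -> 0 <= ramp delta N r.
Proof. by move=> d0 r0; rewrite mulr_ge0 ?sqr_ge0// mulr_ge0// divr_ge0. Qed.

Lemma cutoff0 (R : realType) (N r : R) : 0 < N -> N <= r -> cutoff N r = 0.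
Proof.
move=> N0 Nr; apply/max_idPl; rewrite subr_le0 ler_pdivlMr// mul1r//.
Qed.

Lemma ramp_nondecreasing (R : realType) (delta N N' r : R) :
  0 <= delta -> 0 <= r -> 0 < N -> N <= N' -> ramp delta N r <= ramp delta N' r.
Proof.
move=> d0 r0 N0 NN'; rewrite /ramp ler_wpM2l ?mulr_ge0 ?divr_ge0//.
rewrite ler_sqr ?nnegrE ?cutoff_ge0// /cutoff ge_max !le_max lexx/=.
by rewrite lerB ?orbT// ler_wpM2l// lef_pV2// posrE (lt_le_trans N0).
Qed.

Lemma cvg_ramp (R : realType) (delta r : R) : 0 <= r ->
  ramp delta k.+1%:R r @[k --> \oo] --> delta / 2 * r.
Proof.
move=> r0; rewrite -[X in _ --> X]mulr1; apply: cvgM; first exact: cvg_cst.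
have cut1 : cutoff k.+1%:R r @[k --> \oo] --> (1 : R).
  apply: (@squeeze_cvgr _ _ _ _ (fun k : nat => 1 - r * k.+1%:R^-1) (cst 1)).
  - by near=> k; rewrite cutoff_le1// andbT /cutoff le_max lexx orbT.
  - rewrite -[X in _ --> X]subr0; apply: cvgB; first exact: cvg_cst.
    rewrite -[X in _ --> X](mulr0 r); apply: cvgM; first exact: cvg_cst.
    exact: cvg_harmonic.
  - exact: cvg_cst.
by rewrite -[X in _ --> X](mulr1 1); exact: cvgM.
Unshelve. all: by end_near. Qed.

(** * Inequalities between real numbers *)

(** With [u = t^2], equality holds at [u = 1/2]. *)
Lemma weight_bound (R : realFieldType) (t : R) :
  t ^+ 2 * (1 / (1 + t ^+ 2)) ^+ 3 <= 4 / 27.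
Proof.
have t0 := sqr_ge0 t; move: (t ^+ 2) t0 => u u0.
rewrite mul1r exprVn ler_pdivrMr ?exprn_gt0 ?ltr_wpDr//.
rewrite -subr_ge0 (_ : _ - _ = (2 * u - 1) ^+ 2 * (u + 4) / 27); last by field.
by rewrite divr_ge0// mulr_ge0 ?sqr_ge0// addr_ge0.
Qed.

Lemma weight_tail (R : realFieldType) (t e : R) : 0 < e -> e^-1 <= t ^+ 2 ->
  t ^+ 2 * (1 / (1 + t ^+ 2)) ^+ 3 <= e.
Proof.
move=> e0; have t0 := sqr_ge0 t; move: (t ^+ 2) t0 => u u0 eu.
rewrite mul1r exprVn ler_pdivrMr ?exprn_gt0 ?ltr_wpDr//.
have : 1 <= e * u by rewrite -(mulfV (lt0r_neq0 e0)) ler_pM2l.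
by move=> eu1; rewrite !exprS expr0; nra.
Qed.

(** The contribution of one coordinate to the divergence, where [V1], [V2] stand
for the derivatives of [V], [P] for [E - 1], and [H] for the derivative of the
exponent.  The mixed terms are absorbed by Young's inequality into [a V1^2] and
[s V1^2]; the gradient term then loses its dependence on [t] because
[t^2 <= 1 + t^2]. *)
Lemma coord_divergence_le (R : realFieldType) (a s d V1 V2 t P E H : R) :
  0 < a -> 0 < s -> a + s = 4 / 27 -> `|H| <= d / 2 ->
  let w := 1 / (1 + t ^+ 2) in
  (P ^+ 2 * V2 + 4 * t * P * E * H * V1 - P ^+ 2 * V1 ^+ 2
     - 2 * t * w * P ^+ 2 * V1) * w <=
  - (P ^+ 2 * ((23 / 27 * V1 ^+ 2 - V2) * w)) + P ^+ 2 * (t ^+ 2 * w ^+ 3) / s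
     + d ^+ 2 / a * E ^+ 2.
Proof.
move=> a0 s0 ask Hd; set w := 1 / _ => /=; rewrite -/w.
have w0 : 0 < w by rewrite divr_gt0// ltr_wpDr// sqr_ge0.
have tw : t ^+ 2 * w <= 1.
  by rewrite /w mulrA mulr1 ler_pdivrMr ?ltr_wpDr ?sqr_ge0// mul1r lerDr.
(* The gradient of the test function against that of [V]. *)
have cross : 4 * t * P * E * H * V1 <=
    a * P ^+ 2 * V1 ^+ 2 + 4 * t ^+ 2 * E ^+ 2 * H ^+ 2 / a.
  rewrite -subr_ge0 (_ : _ - _ = (a * P * V1 - 2 * t * E * H) ^+ 2 / a).
    by rewrite divr_ge0 ?sqr_ge0 ?ltW.
  by field; rewrite gt_eqF.
(* The derivative of the weight against that of [V]. *)
have drift : - (2 * t * w * P ^+ 2 * V1) <=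
    P ^+ 2 * (s * V1 ^+ 2) + P ^+ 2 * (t ^+ 2 * w ^+ 2) / s.
  rewrite -subr_ge0 (_ : _ - _ = P ^+ 2 * (s * V1 + t * w) ^+ 2 / s).
    by rewrite divr_ge0 ?(ltW s0)// mulr_ge0// sqr_ge0.
  by field; rewrite gt_eqF.
have H2 : 4 * H ^+ 2 <= d ^+ 2.
  have : `|H| ^+ 2 <= (d / 2) ^+ 2 by rewrite ler_sqr ?nnegrE// (le_trans _ Hd).
  rewrite real_normK ?num_real// expr_div_n ler_pdivlMr ?exprn_gt0//.
  by rewrite (_ : 2 ^+ 2 = 4 :> R) 1?mulrC//; ring.
have grad : 4 * t ^+ 2 * E ^+ 2 * H ^+ 2 / a * w <= d ^+ 2 / a * E ^+ 2.
  rewrite (_ : 4 * t ^+ 2 * E ^+ 2 * H ^+ 2 / a * w =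
    (t ^+ 2 * w) * (4 * H ^+ 2) * (E ^+ 2 / a)); last by ring.
  rewrite (_ : d ^+ 2 / a * E ^+ 2 = 1 * d ^+ 2 * (E ^+ 2 / a)); last by ring.
  rewrite ler_wpM2r ?divr_ge0 ?sqr_ge0 ?(ltW a0)// ler_pM//.
    by rewrite mulr_ge0 ?sqr_ge0 ?(ltW w0).
  by rewrite mulr_ge0 ?sqr_ge0.
apply: le_trans (_ : (- (P ^+ 2 * (23 / 27 * V1 ^+ 2 - V2))
   + P ^+ 2 * (t ^+ 2 * w ^+ 2) / s
   + 4 * t ^+ 2 * E ^+ 2 * H ^+ 2 / a) * w <= _).
  rewrite ler_pM2r// (_ : 23 / 27 = 1 - a - s :> R); last lra.
  lra.
rewrite mulrDl lerD// le_eqVlt; apply/orP; left; apply/eqP; ring.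
Qed.

Lemma square_absorb (R : realFieldType) (A B E : R) : 0 <= A -> 0 < A - B ->
  - (A * (E - 1) ^+ 2) + B * E ^+ 2 <=
  - ((A - B) / 2 * E ^+ 2) + 2 * A ^+ 2 / (A - B).
Proof.
move=> A0 AB; rewrite -subr_ge0.
rewrite (_ : _ - _ = (((A - B) * E - 2 * A) ^+ 2) / (2 * (A - B)) + A).
  by rewrite addr_ge0// divr_ge0 ?sqr_ge0// mulr_ge0// ltW.
by field; rewrite gt_eqF.
Qed.

(** With [al = sqrt m] and [be = sqrt (m - 1)], put [s = (4/27) b / al].  For
[b = be] the gap is positive exactly when [(al - be)^2] exceeds
[D^2 = m delta^2 / (4/27)], which is the hypothesis.  When [m = 1] this would be
[s = 0]; taking [b] slightly larger than [be] treats all [m] alike. *)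
Lemma gap_parameters (R : realType) (m : nat) (delta : R) : (0 < m)%N ->
  0 < delta ->
  delta < 2 * (Num.sqrt m%:R - Num.sqrt (m%:R - 1))
          / (3 * Num.sqrt (3 * m%:R)) ->
  exists a s eta : R, [/\ 0 < a, 0 < s, 0 < eta, a + s = 4 / 27 &
    m%:R * (delta ^+ 2 / a) <
    m%:R - eta - ((m%:R - 1) * (4 / 27) + eta) / s].
Proof.
move=> m0 d0; set al := Num.sqrt m%:R; set be := Num.sqrt (_ - 1).
have m1 : 1 <= m%:R :> R by rewrite ler1n.
have al2 : al ^+ 2 = m%:R by rewrite sqr_sqrtr.
have be2 : be ^+ 2 = m%:R - 1 by rewrite sqr_sqrtr// subr_ge0.
have be0 : 0 <= be by exact: sqrtr_ge0.
have al0 : 0 < al by rewrite sqrtr_gt0 ltr0n.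
set q := Num.sqrt (3 * m%:R).
have q2 : q ^+ 2 = 3 * m%:R by rewrite sqr_sqrtr// mulr_ge0.
have q0 : 0 < q by rewrite sqrtr_gt0 mulr_gt0// ltr0n.
rewrite ltr_pdivlMr ?mulr_gt0// => dlt.
pose D := 3 / 2 * q * delta.
have D0 : 0 < D by rewrite !mulr_gt0.
have D2 : D ^+ 2 = 27 / 4 * (m%:R * delta ^+ 2).
  by rewrite /D !exprMn q2; field.
pose b := (be + (al - D)) / 2.
have [bbe bal] : be < b /\ b < al - D by rewrite /b /D; lra.
have b0 : 0 < b by rewrite (le_lt_trans be0).
have ab0 : 0 < al - b by lra.
pose v := m%:R - (m%:R - 1) * (al / b)
  - m%:R * (delta ^+ 2 / (4 / 27 * (al - b) / al)).
have v0 : 0 < v.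
  have vE : v = al / (al - b) * ((al - b) ^+ 2 - D ^+ 2)
      + al / b * (b ^+ 2 - be ^+ 2).
    rewrite /v D2 be2 -al2; field.
    by rewrite !gt_eqF.
  rewrite vE addr_gt0// mulr_gt0 ?(divr_gt0 al0)//.
    by rewrite subr_gt0 ltr_sqr ?nnegrE ?(ltW D0) ?(ltW ab0)//; lra.
  by rewrite subr_gt0 ltr_sqr ?nnegrE ?(ltW b0).
pose s := 4 / 27 * b / al.
have s0 : 0 < s by rewrite /s divr_gt0// mulr_gt0.
pose eta := v / (2 * (1 + s^-1)).
have eta0 : 0 < eta by rewrite divr_gt0// mulr_gt0// addr_gt0// invr_gt0.
exists (4 / 27 * (al - b) / al), s, eta; split=> //.
- by rewrite divr_gt0// mulr_gt0.
- by rewrite /s; field; rewrite gt_eqF.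
rewrite -subr_gt0 (_ : _ - _ = v - eta * (1 + s^-1)).
  rewrite (_ : eta * _ = v / 2) ; first lra.
  by rewrite /eta; field; rewrite gt_eqF//= gt_eqF// addr_gt0// invr_gt0.
rewrite /v /s; field.
by rewrite !gt_eqF.
Qed.

(** * The squared norm, the weights and continuity *)

Definition sqnorm (R : realType) m (x : 'rV[R]_m) : R := \sum_i x ord0 i ^+ 2.

Lemma sqnorm_ge0 (R : realType) m (x : 'rV[R]_m) : 0 <= sqnorm x.
Proof. by apply: sumr_ge0 => i _; exact: sqr_ge0. Qed.

Lemma enorm_sqr (R : realType) m (x : 'rV[R]_m) : enorm x ^+ 2 = sqnorm x.
Proof. by rewrite sqr_sqrtr// sqnorm_ge0. Qed.

Lemma coord_sqr_le (R : realType) m (x : 'rV[R]_m) i :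
  x ord0 i ^+ 2 <= sqnorm x.
Proof.
by rewrite /sqnorm (bigD1 i)//= lerDl sumr_ge0// => j _; exact: sqr_ge0.
Qed.

Lemma sqnorm_le_cube (R : realType) m (x : 'rV[R]_m) (N : R) :
  sqnorm x <= N -> cube m (N + 1) x.
Proof.
move=> xN i; have := le_trans (coord_sqr_le x i) xN.
rewrite -real_normK ?num_real//; have := normr_ge0 (x ord0 i).
by move: `|x ord0 i| => u u0; rewrite expr2; nra.
Qed.

Lemma is_derive_coord (R : realType) m (x : 'rV[R]_m) (i j : 'I_m) :
  is_derive x (delta_mx ord0 i) (fun y => y ord0 j) ((j == i)%:R : R).
Proof.
apply: (@is_derive_affine _ _ _ _ id (fun y : 'rV[R]_m => y ord0 j) x _
  (j == i)%:R (j == i)%:R _).1.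
by move=> h; rewrite !mxE.
Qed.

Lemma is_derive_cst_sqr (R : realType) (c t : R) :
  is_derive t 1 (fun t : R => c + t ^+ 2) (2 * t).
Proof.
apply: (@is_derive_quadratic _ _ _ _ 1) => h.
by rewrite (_ : _ - _ = h ^+ 2) ?ger0_norm ?sqr_ge0 ?mul1r//; ring.
Qed.

Lemma is_derive_sqnorm (R : realType) m (x : 'rV[R]_m) (i : 'I_m) :
  is_derive x (delta_mx ord0 i) (@sqnorm R m) (2 * x ord0 i).
Proof.
have dsq j : is_derive x (delta_mx ord0 i) (fun y => 0 + y ord0 j ^+ 2)
    (2 * x ord0 j * (j == i)%:R).
  exact: (@is_derive_comp1 _ _ (fun y : 'rV[R]_m => y ord0 j)
    (fun t => 0 + t ^+ 2) _ _ _ _ (is_derive_coord x i j)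
    (is_derive_cst_sqr 0 _)).
have := is_derive_sum dsq.
have -> : \sum_(j < m) (fun y : 'rV[R]_m => 0 + y ord0 j ^+ 2) = @sqnorm R m.
  by apply/funext => y; rewrite fct_sumE; apply: eq_bigr => j _; rewrite add0r.
move=> h; apply: is_derive_eq h _; rewrite (bigD1 i)//= eqxx mulr1.
by rewrite big1 ?addr0// => j ji; rewrite (negbTE ji) mulr0.
Qed.

Section real_continuous.
Variables (R : realType) (T : topologicalType).
Implicit Types f g : T -> R.

Lemma real_continuous_cst (c : R) : continuous (fun _ : T => c).
Proof. by move=> x; exact: cvg_cst. Qed.

Lemma real_continuousD f g : continuous f -> continuous g ->
  continuous (fun x => f x + g x).
Proof. by move=> cf cg x; apply: cvgD; [exact: cf|exact: cg]. Qed.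

Lemma real_continuousN f : continuous f -> continuous (fun x => - f x).
Proof. by move=> cf x; apply: cvgN; exact: cf. Qed.

Lemma real_continuousM f g : continuous f -> continuous g ->
  continuous (fun x => f x * g x).
Proof. by move=> cf cg x; apply: cvgM; [exact: cf|exact: cg]. Qed.

Lemma real_continuous_sqr f : continuous f -> continuous (fun x => f x ^+ 2).
Proof. by move=> cf; exact: (real_continuousM cf cf). Qed.

Lemma real_continuous_expR f :
  continuous f -> continuous (fun x => expR (f x)).
Proof.
by move=> cf x; apply: continuous_comp; [exact: cf|exact: continuous_expR].
Qed.

Lemma real_continuous_sum (I : Type) (s : seq I) (f : I -> T -> R) :
  (forall i, continuous (f i)) -> continuous (fun x => \sum_(i <- s) f i x).
Proof.
move=> cf; elim: s => [|i s IHs].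
  by under eq_fun do rewrite big_nil; exact: real_continuous_cst.
under eq_fun do rewrite big_cons.
exact: real_continuousD.
Qed.

End real_continuous.

Lemma sqnorm_continuous (R : realType) m : continuous (@sqnorm R m).
Proof.
by apply: real_continuous_sum => i; apply: real_continuous_sqr => x;
  exact: coord_continuous.
Qed.

Definition weight (R : realType) m (i : 'I_m) (x : 'rV[R]_m) : R :=
  1 / (1 + x ord0 i ^+ 2).

Lemma weight_continuous (R : realType) m (i : 'I_m) :
  continuous (@weight R m i).
Proof.
have csq : continuous (fun x : 'rV[R]_m => x ord0 i ^+ 2).
  by apply: real_continuous_sqr => y; exact: coord_continuous.
have -> : @weight R m i = fun x => (1 + x ord0 i ^+ 2)^-1.
  by apply/funext => x; rewrite /weight mul1r.
have cw := real_continuousD (@real_continuous_cst R 'rV[R]_m 1) csq.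
by move=> x; apply: (continuousV _ (cw x)); rewrite gt_eqF// ltr_wpDr// sqr_ge0.
Qed.

Lemma is_derive_weight (R : realType) m (x : 'rV[R]_m) (i : 'I_m) :
  is_derive x (delta_mx ord0 i) (weight i) (- (2 * x ord0 i * weight i x ^+ 2)).
Proof.
have dc := is_derive_coord x i i; rewrite eqxx in dc.
have dw : is_derive (x ord0 i) 1 (fun t : R => 1 / (1 + t ^+ 2))
   (- (2 * x ord0 i * weight i x ^+ 2)).
  have t0 : 1 + x ord0 i ^+ 2 != 0 by rewrite gt_eqF// ltr_wpDr// sqr_ge0.
  have := @is_deriveV _ (fun t => 1 + t ^+ 2) _ _ _ t0
    (is_derive_cst_sqr 1 (x ord0 i)).
  rewrite (_ : (fun t => _^-1) = (fun t => 1 / (1 + t ^+ 2))).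
    move=> h; apply: is_derive_eq h _.
    by rewrite /weight -[_ *: _]/(_ * _) mul1r exprVn; ring.
  by apply/funext => t; rewrite mul1r.
by have := is_derive_comp1 dc dw; rewrite mulr1.
Qed.

(** * The vector field and its divergence *)

Section field.
Variables (R : realType) (m : nat) (V : 'rV[R]_m -> R) (delta N : R).

Definition growth (x : 'rV[R]_m) : R := expR (ramp delta N (sqnorm x)).

Definition vfield (i : 'I_m) (x : 'rV[R]_m) : R :=
  (growth x - 1) ^+ 2 * expR (- V x) * weight i x * partial i V x.

Definition dvfield (i : 'I_m) (x : 'rV[R]_m) : R :=
  expR (- V x) *
  (((growth x - 1) ^+ 2 * partial i (partial i V) x
   + 4 * x ord0 i * (growth x - 1) * growth x * dramp delta N (sqnorm x)
      * partial i V x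
   - (growth x - 1) ^+ 2 * partial i V x ^+ 2
   - 2 * x ord0 i * weight i x * (growth x - 1) ^+ 2 * partial i V x)
    * weight i x).

Hypotheses (V_C2 : Ck 2 V) (N_gt0 : 0 < N).

Lemma is_derive_vfield (i : 'I_m) (x : 'rV[R]_m) :
  is_derive x (delta_mx ord0 i) (vfield i) (dvfield i x).
Proof.
have [_ /(_ i)[dV [_ /(_ i)[ddV _]]]] := V_C2.
have dr := is_derive_comp1 (is_derive_sqnorm x i)
  (is_derive_ramp delta (sqnorm x) N_gt0).
have dg : is_derive x (delta_mx ord0 i) growth
    (growth x * (dramp delta N (sqnorm x) * (2 * x ord0 i))).
  exact: is_derive_comp1 dr (is_derive_expR _).
have dg1 := is_deriveB dg (is_derive_cst (1 : R) x (delta_mx ord0 i)).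
have de : is_derive x (delta_mx ord0 i) (fun x => expR (- V x))
    (expR (- V x) * - partial i V x).
  have := is_deriveN (derivableP (dV x)).
  by move=> /is_derive_comp1 /(_ (is_derive_expR _)).
have := is_deriveM (is_deriveM (is_deriveM (is_deriveX 2 dg1) de)
  (is_derive_weight x i)) (derivableP (ddV x)).
move=> h; apply: is_derive_eq h _.
rewrite /dvfield -![_ *: _]/(_ * _) !fctE.
by rewrite -/(partial i (partial i V) x) /= subr0 expr1; ring.
Qed.

Lemma growth_continuous : continuous growth.
Proof.
move=> x; apply: continuous_comp; last exact: continuous_expR.
apply: continuous_comp; first exact: sqnorm_continuous.
apply/differentiable_continuous/derivable1_diffP.
by have [] := is_derive_ramp delta (sqnorm x) N_gt0.
Qed.

Lemma dramp_continuous :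
  continuous (fun x : 'rV[R]_m => dramp delta N (sqnorm x)).
Proof.
have ccut : continuous (fun x : 'rV[R]_m => cutoff N (sqnorm x)).
  move=> x; apply: (@continuous_max _ _ (fun=> 0) (fun x => 1 - sqnorm x / N)).
    exact: real_continuous_cst.
  move: x; apply: real_continuousD; first exact: real_continuous_cst.
  apply: real_continuousN; apply: real_continuousM.
    exact: sqnorm_continuous.
  exact: real_continuous_cst.
apply: real_continuousM; first exact: real_continuous_cst.
apply: real_continuousM => //; apply: real_continuousD.
  by apply: real_continuousM => //; exact: real_continuous_cst.
exact: real_continuous_cst.
Qed.

Lemma dvfield_continuous (i : 'I_m) : continuous (dvfield i).
Proof.
have [cV /(_ i)[_ [cdV /(_ i)[_ [cddV _]]]]] := V_C2.
have cg := growth_continuous; have ch := dramp_continuous.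
have cw := @weight_continuous R m i.
have cx : continuous (fun x : 'rV[R]_m => x ord0 i) by exact: coord_continuous.
have cP2 : continuous (fun x => (growth x - 1) ^+ 2).
  apply/real_continuous_sqr/real_continuousD => //.
  exact: real_continuous_cst.
apply: real_continuousM; first exact/real_continuous_expR/real_continuousN.
have cst (c : R) := @real_continuous_cst R 'rV[R]_m c.
by do ![exact: cst | assumption | apply: real_continuousD
  | apply: real_continuousN | apply: real_continuous_sqr
  | apply: real_continuousM].
Qed.

(** Where the cutoff vanishes, the test function equals 1 and so [growth - 1]
is zero. *)
Lemma vfield_off_cube (i : 'I_m) (x : 'rV[R]_m) : ~ cube m (N + 1) x ->
  vfield i x = 0 /\ dvfield i x = 0.
Proof.
move=> xN; have c0 : cutoff N (sqnorm x) = 0.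
  apply: cutoff0 => //; rewrite leNgt; apply/negP => /ltW/sqnorm_le_cube.
  exact: xN.
by rewrite /vfield /dvfield /growth /ramp /dramp c0 expr0n/= !(mulr0, mul0r)
  expR0 subrr expr0n/= !(mul0r, mulr0, addr0, subr0).
Qed.

Lemma integrable_divergence :
  (lebesgue_rV m).-integrable setT (fun x => (\sum_i dvfield i x)%:E).
Proof.
apply: (@integrable_continuous_cube _ _ _ (N + 1)).
  by apply: real_continuous_sum => i; exact: dvfield_continuous.
by move=> x xN; apply: big1 => i _; exact: (vfield_off_cube i xN).2.
Qed.

Lemma integral_divergence :
  (\int[lebesgue_rV m]_x (\sum_i dvfield i x)%:E = 0)%E.
Proof.
under eq_integral do rewrite -sumEFin.
rewrite integral_sum//.
  rewrite big1// => i _.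
  apply: (@integral_partial_eq0 _ _ i (vfield i) _ (N + 1)).
  - exact: is_derive_vfield.
  - exact: dvfield_continuous.
  - exact: vfield_off_cube.
move=> i; apply: (@integrable_continuous_cube _ _ _ (N + 1)).
  exact: dvfield_continuous.
by move=> x /(vfield_off_cube i)[].
Qed.

End field.

(** * The estimate of the divergence *)

(** If [|x|^2 > m / eta], some coordinate satisfies [x_i^2 >= 1 / eta] and its
term is at most [eta]; the others are bounded by [4/27] each. *)
Lemma weight_sum_tail (R : realType) m (x : 'rV[R]_m) (eta : R) : 0 < eta ->
  m%:R / eta < sqnorm x ->
  \sum_i x ord0 i ^+ 2 * weight i x ^+ 3 <= (m%:R - 1) * (4 / 27) + eta.
Proof.
move=> eta0 xm.
have [[i xi]|far] := pselect (exists i, eta^-1 <= x ord0 i ^+ 2).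
  rewrite (bigD1 i)//= addrC lerD ?weight_tail//.
  apply: le_trans (ler_sum _ (fun j _ => weight_bound (x ord0 j))) _.
  rewrite sumr_const cardC1 card_ord -[X in X <= _]mulr_natl.
  case: m {xm} x i {xi} => [x []//|m' x i] /=.
  by rewrite -[m'.+1%:R]natr1 addrK.
exfalso; move: xm; apply/negP; rewrite -leNgt /sqnorm.
have -> : m%:R / eta = \sum_(i < m) eta^-1.
  by rewrite sumr_const card_ord mulr_natl.
apply: ler_sum => i _; rewrite leNgt; apply/negP => /ltW xi.
by apply: far; exists i.
Qed.

Definition lyapunov_sum (R : realType) m (V : 'rV[R]_m -> R)
    (x : 'rV[R]_m) : R :=
  \sum_(i < m) (23 / 27 * partial i V x ^+ 2 - partial i (partial i V) x)
         * (1 / (1 + x ord0 i ^+ 2)).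

Lemma lyapunov_sum_continuous (R : realType) m (V : 'rV[R]_m -> R) :
  Ck 2 V -> continuous (lyapunov_sum V).
Proof.
move=> [cV dV]; apply: real_continuous_sum => i.
have [_ [cdV /(_ i)[_ [cddV _]]]] := dV i.
apply: real_continuousM; last exact: weight_continuous.
apply: real_continuousD; last exact: real_continuousN.
apply: real_continuousM; first exact: real_continuous_cst.
exact: real_continuous_sqr.
Qed.

Lemma lt_limf_einf (R : realType) (T : choiceType) (X : filteredType T)
    (f : X -> R) (F : set_system X) (l e : R) : 0 < e ->
  (l%:E <= limf_einf (EFin \o f) F)%E ->
  exists2 A, F A & forall x, A x -> l - e < f x.
Proof.
move=> e0; rewrite /limf_einf limf_esupE leeNr => lf.
have : (ereal_inf [set ereal_sup [set (\- (EFin \o f))%E x | x in A] | A in F]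
    < (- (l - e))%:E)%E.
  by apply: le_lt_trans lf _; rewrite -EFinN lte_fin; lra.
move=> /ereal_inf_lt[_ [A FA <-] Al]; exists A => // x Ax.
have : ((- f x)%:E < (- (l - e))%:E)%E.
  by apply: le_lt_trans Al; apply: ereal_sup_ubound; exists x.
by rewrite lte_fin ltrN2.
Qed.

Section estimate.
Variables (R : realType) (m : nat) (V : 'rV[R]_m -> R) (delta : R).

Lemma divergence_le (a s N : R) (x : 'rV[R]_m) :
  0 <= delta -> 0 < N -> 0 < a -> 0 < s -> a + s = 4 / 27 ->
  let E := growth delta N x in
  \sum_i dvfield V delta N i x <= expR (- V x) *
    (- ((E - 1) ^+ 2 * lyapunov_sum V x)
     + (E - 1) ^+ 2 * (\sum_i x ord0 i ^+ 2 * weight i x ^+ 3) / s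
     + m%:R * (delta ^+ 2 / a) * E ^+ 2).
Proof.
move=> d0 N0 a0 s0 ask; set E := growth delta N x => /=; rewrite -/E.
rewrite -mulr_sumr ler_pM2l ?expR_gt0//.
have Hd := norm_dramp_le d0 N0 (sqnorm_ge0 x).
apply: le_trans (ler_sum _ (fun i _ => coord_divergence_le
  (partial i V x) (partial i (partial i V) x) (x ord0 i) (E - 1) E
  a0 s0 ask Hd)) _.
rewrite !big_split/= sumrN -!mulr_sumr -mulr_suml sumr_const card_ord.
rewrite -mulr_sumr.
rewrite (_ : _ * (E * (E *+ m)) = m%:R * (delta ^+ 2 / a) * E ^+ 2)//.
by rewrite -[E *+ m]mulr_natl; ring.
Qed.

Hypotheses (m_gt0 : (0 < m)%N) (V_C2 : Ck 2 V).
Hypothesis liminf_ge :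
  ((m%:R : R)%:E <= limf_einf (EFin \o lyapunov_sum V) enorm_pinfty)%E.
Hypotheses (delta_gt0 : 0 < delta).
Hypothesis delta_lt : delta < 2 * (Num.sqrt m%:R - Num.sqrt (m%:R - 1))
                        / (3 * Num.sqrt (3 * m%:R)).

(** Outside a ball the gap [B < A] lets [- A (E - 1)^2] dominate [B E^2]; inside
it everything is bounded, [E] being at most [exp (delta L / 2)] there for every
truncation [N]. *)
Lemma divergence_le_growth : exists c K : R, 0 < c /\
  forall N x, 0 < N -> \sum_i dvfield V delta N i x <=
    expR (- V x) * (K - c * growth delta N x ^+ 2).
Proof.
have [a [s [eta [a0 s0 eta0 ask gap]]]] :=
  gap_parameters m_gt0 delta_gt0 delta_lt.
set B := m%:R * (delta ^+ 2 / a) in gap.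
set A := m%:R - eta - _ / s in gap.
have B0 : 0 <= B by rewrite mulr_ge0 ?divr_ge0 ?sqr_ge0 ?(ltW a0).
have [S [rho _ rhoS] VS] := lt_limf_einf eta0 liminf_ge.
pose L := rho ^+ 2 + m%:R / eta.
have L0 : 0 <= L by rewrite addr_ge0 ?sqr_ge0 ?divr_ge0 ?(ltW eta0).
have [M VM] := continuous_cube_bounded (L + 1)
  (real_continuousN (lyapunov_sum_continuous V_C2)).
pose c := (A - B) / 2; have c0 : 0 < c by rewrite divr_gt0// subr_gt0.
have A0 : 0 <= A by rewrite (le_trans B0)// ltW.
pose EL := expR (delta / 2 * L).
(* [K1] serves outside the ball [sqnorm x <= L], and [K2] inside. *)
pose K1 := 2 * A ^+ 2 / (A - B).
pose K2 := (`|M| + m%:R * (4 / 27) / s + B + c) * EL ^+ 2.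
exists c, (K1 + K2); split=> // N x N0.
have K10 : 0 <= K1 by rewrite divr_ge0 ?mulr_ge0 ?sqr_ge0// subr_ge0 ltW.
have K20 : 0 <= K2.
  rewrite mulr_ge0 ?sqr_ge0// !addr_ge0 ?(ltW c0)//.
  by rewrite divr_ge0 ?(ltW s0)// mulr_ge0.
apply: le_trans (divergence_le x (ltW delta_gt0) N0 a0 s0 ask) _ => /=.
rewrite ler_pM2l ?expR_gt0// -/B.
have E1 : 1 <= growth delta N x.
  by rewrite -expR0 ler_expR ramp_ge0 ?sqnorm_ge0// ltW.
set E := growth delta N x in E1 *; set T := \sum_i _.
have [xL|xL] := leP (sqnorm x) L.
- have EEL : E <= EL.
    rewrite ler_expR (le_trans (ramp_le (ltW delta_gt0) N0 (sqnorm_ge0 x)))//.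
    by rewrite ler_wpM2l// divr_ge0// ltW.
  have TM : T <= m%:R * (4 / 27).
    apply: le_trans (ler_sum _ (fun j _ => weight_bound (x ord0 j))) _.
    by rewrite sumr_const card_ord -[leLHS]mulr_natl.
  have VMx := VM x (sqnorm_le_cube xL).
  have P0 := sqr_ge0 (E - 1).
  have P2 : (E - 1) ^+ 2 <= EL ^+ 2 by rewrite ler_sqr ?nnegrE; lra.
  have E2 : E ^+ 2 <= EL ^+ 2 by rewrite ler_sqr ?nnegrE; lra.
  have potM : - ((E - 1) ^+ 2 * lyapunov_sum V x) <= EL ^+ 2 * `|M|.
    rewrite -mulrN (le_trans (ler_wpM2l P0 VMx))//.
    by rewrite (le_trans (ler_wpM2l P0 (ler_norm M)))// ler_wpM2r.
  have TsM : (E - 1) ^+ 2 * T / s <= EL ^+ 2 * (m%:R * (4 / 27) / s).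
    rewrite -mulrA ler_pM// ?divr_ge0 ?(ltW s0)// ?sumr_ge0// => [i _|].
      by rewrite mulr_ge0 ?sqr_ge0// exprn_ge0// divr_ge0// addr_ge0// sqr_ge0.
    by rewrite ler_pM2r ?invr_gt0.
  have BE : B * E ^+ 2 <= EL ^+ 2 * B by rewrite mulrC ler_wpM2r.
  have cE : c * E ^+ 2 <= EL ^+ 2 * c by rewrite mulrC ler_pM2r.
  rewrite /K2; lra.
- have TA : T <= (m%:R - 1) * (4 / 27) + eta.
    apply: weight_sum_tail => //; apply: le_lt_trans xL.
    by rewrite lerDr sqr_ge0.
  have Q : m%:R - eta < lyapunov_sum V x.
    apply: VS; apply: rhoS => /=; rewrite (le_lt_trans (ler_norm rho))//.
    have rx : rho ^+ 2 < sqnorm x.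
      by apply: le_lt_trans xL; rewrite lerDl divr_ge0// ltW.
    by rewrite -sqrtr_sqr ltr_sqrt// (le_lt_trans (sqr_ge0 rho)).
  have P0 := sqr_ge0 (E - 1).
  have Ts : T / s <= ((m%:R - 1) * (4 / 27) + eta) / s.
    by rewrite ler_pM2r ?invr_gt0.
  have : - ((E - 1) ^+ 2 * lyapunov_sum V x) + (E - 1) ^+ 2 * T / s <=
      - (A * (E - 1) ^+ 2).
    rewrite -mulrA -mulrN -mulrDr (mulrC A) -mulrN ler_wpM2l// /A; lra.
  have := @square_absorb _ A B E A0; rewrite subr_gt0 => /(_ gap).
  rewrite -/K1 -/c.
  lra.
Qed.

End estimate.

(** * Exponential moments *)

(** Both [g] and the Radon-Nikodym derivative have the same integrals over
measurable sets, hence agree almost everywhere. *)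
Lemma ge0_integral_density d (T : measurableType d) (R : realType)
    (nu : {finite_measure set T -> \bar R})
    (mu : {sigma_finite_measure set T -> \bar R}) (g : T -> \bar R) :
  measurable_fun setT g -> (forall x, 0 <= g x)%E ->
  (forall A, measurable A -> nu A = \int[mu]_(x in A) g x)%E ->
  forall f : T -> \bar R, measurable_fun setT f -> (forall x, 0 <= f x)%E ->
  (\int[nu]_x f x = \int[mu]_x (f x * g x))%E.
Proof.
move=> mg g0 nuE f mf f0.
have numu : nu `<< mu.
  apply/null_content_dominatesP => A mA muA0.
  by rewrite nuE// null_set_integral//; exact: measurable_funTS.
have irn := Radon_Nikodym_SigmaFinite.f_integrable numu.
rewrite -(Radon_Nikodym_SigmaFinite.change_of_variables numu f0 measurableT mf).
apply: ae_eq_integral => //.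
- by apply: emeasurable_funM => //; exact: measurable_int irn.
- exact: emeasurable_funM.
apply: (@ae_eqe_mul2l _ _ _ mu setT _ _ f) => //.
apply: integral_ae_eq => // A _ mA.
by rewrite -nuE// (Radon_Nikodym_SigmaFinite.f_integral numu).
Qed.

Section exponential_moment.
Variables (R : realType) (m : nat) (V : 'rV[R]_m -> R) (delta : R).
Hypotheses (V_C2 : Ck 2 V).
Hypothesis V_mass : (\int[lebesgue_rV m]_x (expR (- V x))%:E = 1)%E.

Let measurable_density : measurable_fun setT (fun x => expR (- V x)).
Proof.
have [cV _] := V_C2.
exact: (continuous_measurable_rV (real_continuous_expR (real_continuousN cV))).
Qed.

Let integrable_density :
  (lebesgue_rV m).-integrable setT (fun x => (expR (- V x))%:E).
Proof.
apply/integrableP; split; first exact/measurable_EFinP.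
under eq_integral do rewrite gee0_abs ?lee_fin ?expR_ge0//.
by rewrite V_mass ltry.
Qed.

Lemma integral_growth_le (c K N : R) : 0 < c -> 0 < N ->
  (forall x, \sum_i dvfield V delta N i x <=
    expR (- V x) * (K - c * growth delta N x ^+ 2)) ->
  (\int[lebesgue_rV m]_x (growth delta N x ^+ 2 * expR (- V x))%:E
    <= (K / c)%:E)%E.
Proof.
move=> c0 N0 divK.
have idiv := integrable_divergence delta V_C2 N0.
have le_pt x : growth delta N x ^+ 2 * expR (- V x) <=
    K / c * expR (- V x) - c^-1 * \sum_i dvfield V delta N i x.
  rewrite -(ler_pM2l c0) mulrBr !mulrA mulfV ?gt_eqF// mul1r.
  rewrite (mulrC c K) mulfK ?gt_eqF//; have := divK x.
  lra.
apply: (@le_trans _ _ (\int[lebesgue_rV m]_x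
  (((K / c)%:E * (expR (- V x))%:E) -
   (c^-1%:E * (\sum_i dvfield V delta N i x)%:E)))%E).
  apply: ge0_le_integral => //.
  - by move=> x _; rewrite lee_fin mulr_ge0 ?sqr_ge0 ?expR_ge0.
  - apply/measurable_EFinP/measurable_funM => //; apply: measurable_funX.
    by apply: continuous_measurable_rV; exact: growth_continuous.
  - apply: emeasurable_funB; apply: emeasurable_funM => //.
      exact: measurable_int integrable_density.
    exact: measurable_int idiv.
  - by move=> x _; rewrite -!EFinM -EFinB lee_fin.
rewrite integralB//; [|exact: integrableZl..].
rewrite !integralZl// V_mass integral_divergence// mule0 sube0 mule1//.
Qed.

Lemma exponential_moment_lty (c K : R) : 0 <= delta -> 0 < c ->
  (forall N x, 0 < N -> \sum_i dvfield V delta N i x <=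
    expR (- V x) * (K - c * growth delta N x ^+ 2)) ->
  (\int[lebesgue_rV m]_x (expR (delta * sqnorm x) * expR (- V x))%:E < +oo)%E.
Proof.
move=> d0 c0 divK.
pose g k (x : 'rV[R]_m) := (growth delta k.+1%:R x ^+ 2 * expR (- V x))%:E.
have k0 k : (0 : R) < k.+1%:R by rewrite ltr0n.
have gcvg x : g k x @[k --> \oo] -->
    (expR (delta * sqnorm x) * expR (- V x))%:E.
  apply: cvg_EFin; first by near=> k.
  apply: cvgMr_tmp.
  have -> : delta * sqnorm x = delta / 2 * sqnorm x *+ 2.
    by rewrite mulr2n; field.
  under eq_fun do rewrite /growth -expRM_natr mulr_natr.
  apply: continuous_cvg; first exact: continuous_expR.
  by rewrite mulr2n; under eq_fun do rewrite mulr2n;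
    apply: cvgD; exact: cvg_ramp (sqnorm_ge0 x).
have gint : (\int[lebesgue_rV m]_x g k x)%E @[k --> \oo] -->
    (\int[lebesgue_rV m]_x (expR (delta * sqnorm x) * expR (- V x))%:E)%E.
  have -> : (fun x => (expR (delta * sqnorm x) * expR (- V x))%:E) =
      (fun x => limn (g ^~ x)).
    by apply/funext => x; apply/esym/cvg_lim => //; exact: gcvg.
  apply: cvg_monotone_convergence => //.
  - move=> k; apply/measurable_EFinP/measurable_funM => //.
    apply/measurable_funX; apply: continuous_measurable_rV.
    exact: growth_continuous.
  - by move=> k x _; rewrite lee_fin mulr_ge0 ?sqr_ge0 ?expR_ge0.
  - move=> x _ k l kl; rewrite lee_fin ler_pM2r ?expR_gt0//.
    rewrite ler_sqr ?nnegrE ?expR_ge0// ler_expR.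
    by rewrite ramp_nondecreasing ?sqnorm_ge0// ler_nat.
rewrite -(cvg_lim _ gint)//; apply: le_lt_trans (ltry (K / c)).
apply: lime_le; first by apply/cvg_ex; eexists; exact: gint.
by near=> k; apply: integral_growth_le => // x; exact: divK.
Unshelve. all: by end_near. Qed.

End exponential_moment.

Theorem proposition1p8 (R : realType) (m : nat) (m_gt0 : (0 < m)%N)
    (V : 'rV[R]_m -> R) (V_C2 : Ck 2 V)
    (mu : probability 'rV[R]_m R)
    (muE : forall A, measurable A ->
      mu A = (\int[lebesgue_rV m]_(x in A) (expR (- V x))%:E)%E)
    (liminf_ge : ((m%:R : R)%:E <= limf_einf (fun x : 'rV[R]_m =>
      (\sum_(i < m) (23 / 27 * partial i V x ^+ 2 - partial i (partial i V) x)
         * (1 / (1 + x ord0 i ^+ 2)))%:E) enorm_pinfty)%E)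
    (delta : R)
    (delta_lt : delta < 2 * (Num.sqrt m%:R - Num.sqrt (m%:R - 1))
                        / (3 * Num.sqrt (3 * m%:R))) :
  (\int[mu]_x (expR (delta * enorm x ^+ 2))%:E < +oo)%E.
Proof.
set bound := 2 * _ / _ in delta_lt.
have bound0 : 0 < bound.
  rewrite divr_gt0 ?mulr_gt0 ?sqrtr_gt0 ?mulr_gt0 ?ltr0n// subr_gt0.
  by rewrite ltr_sqrt ?ltr0n// gtrBl.
(* A positive exponent is needed for the estimates; the integral is monotone
   in the exponent. *)
pose d := Num.max delta (bound / 2).
have d0 : 0 < d by rewrite lt_max divr_gt0 ?orbT.
have dlt : d < bound by rewrite gt_max delta_lt ltr_pdivrMr// ltr_pMr// ltr1n.
have [c [K [c0 divK]]] := divergence_le_growth m_gt0 V_C2 liminf_ge d0 dlt.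
have V_mass : (\int[lebesgue_rV m]_x (expR (- V x))%:E = 1)%E.
  by rewrite -muE// probability_setT.
have csq (t : R) : continuous (fun x : 'rV[R]_m => expR (t * sqnorm x)).
  apply: real_continuous_expR; apply: real_continuousM.
    exact: real_continuous_cst.
  exact: sqnorm_continuous.
have cV : continuous (fun x => expR (- V x)).
  have [cV0 _] := V_C2; exact: (real_continuous_expR (real_continuousN cV0)).
have mEFin (f : 'rV[R]_m -> R) : continuous f ->
    measurable_fun setT (fun x => (f x)%:E).
  by move=> cf; apply/measurable_EFinP; exact: continuous_measurable_rV.
under eq_integral do rewrite enorm_sqr.
have exp_ge0 (f : 'rV[R]_m -> R) x : (0 <= (expR (f x))%:E)%E.
  by rewrite lee_fin expR_ge0.
rewrite (ge0_integral_density (mEFin _ cV) (exp_ge0 _) muE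
  (mEFin _ (csq delta))); last exact: exp_ge0.
apply: le_lt_trans (exponential_moment_lty V_C2 V_mass (ltW d0) c0 divK).
apply: ge0_le_integral => //.
- by apply: emeasurable_funM; exact: mEFin.
- by apply: mEFin; exact: real_continuousM.
- move=> x _; rewrite -EFinM lee_fin ler_pM2r ?expR_gt0// ler_expR.
  by rewrite ler_wpM2r ?sqnorm_ge0// le_max lexx.
Qed.
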